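(* Let $d\ge1$ and let $Y_1,\ldots,Y_n$ be an i.i.d. sample from the spherical Cauchy distribution $C_d^*(\phi)$, $\|\phi\|<1$ (with no $Y_j$ equal to $e_{d+1}$, which holds almost surely). Then the maximum likelihood estimator of $\phi$ is equal to $\mathcal{P}^{-1}(\hat\theta)$, where $\hat\theta$ is the maximum likelihood estimator of the parameter $\theta=\mu+i\sigma$ ($\mu\in\mathbb{R}^d$, $\sigma>0$) of the $d$-variate $t$-distribution with $d$ degrees of freedom $C_d(\theta)$ for the sample $\mathcal{P}(Y_1),\ldots,\mathcal{P}(Y_n)$. That is, $\hat\phi$ maximizes the likelihood $\prod_{j}f(Y_j;\phi)$ of $C_d^*(\phi)$ over $\|\phi\|<1$ if and only if $\hat\phi=\mathcal{P}^{-1}(\hat\theta)$ for some $\hat\theta$ maximizing the likelihood $\prod_jf(\mathcal{P}(Y_j);\theta)$ of $C_d(\theta)$ over $\mu\in\mathbb{R}^d$, $\sigma>0$.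
   Context: $S^d=\{x\in\mathbb{R}^{d+1}:\|x\|=1\}$; $e_{d+1}$ is the $(d+1)$-th standard unit vector. $\mathbb{R}^d+i\mathbb{R}$ is the set of formal expressions $\theta=\mu+i\sigma$, $\mu\in\mathbb{R}^d$, $\sigma\in\mathbb{R}$, with $\mu+i0$ identified with $\mu$. $C_d^*(\phi)$ is the distribution on $S^d$ with density with respect to surface area $$f(y;\phi)=\frac{\Gamma\{(d+1)/2\}}{2\pi^{(d+1)/2}}\left(\frac{|1-\|\phi\|^2|}{\|y-\phi\|^2}\right)^d,\quad y\in S^d.$$ $C_d(\theta)$, $\theta=\mu+i\sigma$, $\sigma\ne0$, is the distribution on $\mathbb{R}^d$ with density $$f(x;\theta)=\frac{2^{d-1}\Gamma\{(d+1)/2\}}{\pi^{(d+1)/2}}\left(\frac{|\sigma|}{\sigma^2+\|x-\mu\|^2}\right)^d.$$ $\mathcal{P}$ is the bijection from $\mathbb{R}^{d+1}\cup\{\infty\}$ onto $(\mathbb{R}^d+i\mathbb{R})\cup\{\infty\}$ given by $$\mathcal{P}(x)=2\frac{(x_1,\ldots,x_d)^T}{\|x-e_{d+1}\|^2}+i\,\frac{1-\|x\|^2}{\|x-e_{d+1}\|^2},\quad x\ne e_{d+1},\infty,$$ $\mathcal{P}(\infty)=-i$, $\mathcal{P}(e_{d+1})=\infty$, with inverse $\mathcal{P}^{-1}(\mu+i\sigma)=\frac{2}{\|\mu\|^2+(1+\sigma)^2}\left(\mu^T,\frac{\|\mu\|^2+\sigma^2-1}{2}\right)^T$ for $\mu+i\sigma\ne-i$.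 *)

(* Defs.v *)
From HB Require Import structures.
From mathcomp Require Import all_boot all_order all_algebra.
From mathcomp Require Import all_classical all_reals all_analysis.
From mathcomp Require Import measurable_realfun.

Set Implicit Arguments.
Unset Strict Implicit.
Unset Printing Implicit Defensive.

Import Order.TTheory GRing.Theory Num.Theory.
Import numFieldNormedType.Exports.

Local Open Scope classical_set_scope.
Local Open Scope ring_scope.

(** Borel sets of R^n: the product sigma-algebra generated by the coordinates. *)
Section measurable_rV.
Context (R : realType) (n : nat).

Definition coord_rV (i : 'I_n) (x : 'rV[R]_n) : measurableTypeR R := x 0 i.

Let rV_set0 : g_sigma_preimage coord_rV set0.
Proof. exact: sigma_algebra0. Qed.

Let rV_setC A : g_sigma_preimage coord_rV A -> g_sigma_preimage coord_rV (~` A).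
Proof. exact: sigma_algebraC. Qed.

Let rV_bigcup (F : _^nat) : (forall i, g_sigma_preimage coord_rV (F i)) ->
  g_sigma_preimage coord_rV (\bigcup_i (F i)).
Proof. exact: sigma_algebra_bigcup. Qed.

HB.instance Definition _ := @isMeasurable.Build default_measure_display
  'rV[R]_n (g_sigma_preimage coord_rV) rV_set0 rV_setC rV_bigcup.

End measurable_rV.

Lemma measurable_coord_rV (R : realType) n (i : 'I_n) :
  measurable_fun [set: 'rV[R]_n] (coord_rV i).
Proof.
move=> _ Y mY; rewrite setTI; apply: sub_sigma_algebra => /=.
rewrite -bigcup_seq/=; exists i => /=; first by rewrite mem_index_enum.
by exists Y => //; rewrite setTI.
Qed.

Lemma measurable_fun_rV d (T : measurableType d) (R : realType) n
    (f : T -> 'rV[R]_n) :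
  (forall i, measurable_fun [set: T] (coord_rV i \o f)) ->
  measurable_fun [set: T] f.
Proof.
move=> mf; suff h : g_sigma_preimage (fun i => coord_rV i \o f) `<=` measurable.
  move: h; rewrite g_sigma_preimage_comp => h _ A mA.
  by apply: h; exists A.
apply: smallest_sub; first exact: sigma_algebra_measurable.
case: n => [|n] in f mf *; first by rewrite big_ord0.
rewrite -bigcup_mkord_ord; apply: bigcup_sub => i Ii.
by move=> A [B mB <-]; exact: mf.
Qed.

(** Lebesgue measure on R^n, as an iterated product measure. *)
Section lebesgue_rV.
Context {R : realType}.

Definition cons_rV n (p : measurableTypeR R * 'rV[R]_n) : 'rV[R]_n.+1 :=
  row_mx (const_mx p.1 : 'rV[R]_1) p.2.

Let uncons_rV n (x : 'rV[R]_n.+1) : measurableTypeR R * 'rV[R]_n :=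
  ((x : 'rV[R]_(1 + n)) 0 (lshift n ord0), rsubmx (x : 'rV[R]_(1 + n))).

Let cons_rVK n : cancel (@cons_rV n) (@uncons_rV n).
Proof.
by move=> [a v]; rewrite /uncons_rV /cons_rV/= row_mxEl mxE row_mxKr.
Qed.

Lemma measurable_cons_rV n : measurable_fun setT (@cons_rV n).
Proof.
apply: measurable_fun_rV => i.
rewrite -[i](@splitK 1 n); case: (@fintype.split 1 n i) => j /=.
  rewrite (_ : _ \o _ = fst)//; apply/funext => p /=.
  by rewrite /coord_rV/cons_rV [LHS](@row_mxEl _ 1 1 n) mxE.
rewrite (_ : _ \o _ = coord_rV j \o snd); last first.
  by apply/funext => p /=; rewrite /coord_rV/cons_rV [LHS](@row_mxEr _ 1 1 n).
by apply: measurableT_comp => //; exact: measurable_coord_rV.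
Qed.

Let measurable_uncons_rV n : measurable_fun setT (@uncons_rV n).
Proof.
apply/measurable_fun_pairP; split; first exact: measurable_coord_rV.
apply: measurable_fun_rV => i.
rewrite (_ : _ \o _ = coord_rV (rshift 1 i)); first exact: measurable_coord_rV.
by apply/funext => x /=; rewrite /coord_rV mxE.
Qed.

Section step.
Variables (n : nat) (mu : {sigma_finite_measure set 'rV[R]_n -> \bar R}).

Definition lebesgue_rVS : set 'rV[R]_n.+1 -> \bar R :=
  pushforward (@lebesgue_measure R \x mu)%E (@cons_rV n).

Let mcons : measurable_fun setT (@cons_rV n) := @measurable_cons_rV n.

Let lebesgue_rVS0 : lebesgue_rVS set0 = 0%E.
Proof. exact: measure0. Qed.

Let lebesgue_rVS_ge0 A : (0 <= lebesgue_rVS A)%E.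
Proof. exact: measure_ge0. Qed.

Let lebesgue_rVS_sigma_additive : semi_sigma_additive lebesgue_rVS.
Proof. exact: measure_semi_sigma_additive. Qed.

HB.instance Definition _ := isMeasure.Build _ _ _ lebesgue_rVS
  lebesgue_rVS0 lebesgue_rVS_ge0 lebesgue_rVS_sigma_additive.

Let lebesgue_rVS_sigma_finite : sigma_finite setT lebesgue_rVS.
Proof.
have /sigma_finiteP[F [TF ndF Foo]] := sigma_finiteT (@lebesgue_measure R).
have /sigma_finiteP[G [TG ndG Goo]] := sigma_finiteT mu.
exists (fun i => @uncons_rV n @^-1` (F i `*` G i)) => [|i].
  rewrite -preimage_bigcup (_ : \bigcup_i _ = setT) ?preimage_setT//.
  rewrite -setXTT TF TG predeqE => -[x y]; split.
    by move=> [k _ []/= ? ?]; split; exists k.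
  move=> [/= [k _ Fkx] [l _ Gly]]; exists (maxn k l) => //; split.
    by move: x Fkx; exact/subsetPset/ndF/leq_maxl.
  by move: y Gly; exact/subsetPset/ndG/leq_maxr.
have [mFi Fioo] := Foo i; have [mGi Gioo] := Goo i; split.
  rewrite -[X in measurable X]setTI; apply: measurable_uncons_rV => //.
  exact: measurableX.
rewrite /lebesgue_rVS /pushforward -comp_preimage.
rewrite (_ : _ \o _ = id); last by apply/funext => p; exact: cons_rVK.
by rewrite preimage_id product_measure1E// lte_mul_pinfty// ge0_fin_numE.
Qed.

HB.instance Definition _ := Measure_isSigmaFinite.Build _ _ _ lebesgue_rVS
  lebesgue_rVS_sigma_finite.

End step.

Fixpoint lebesgue_rV n : {sigma_finite_measure set 'rV[R]_n -> \bar R} :=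
  match n with
  | 0 => @dirac _ 'rV[R]_0 0 R
  | m.+1 => lebesgue_rVS (lebesgue_rV m)
  end.

End lebesgue_rV.

(** The Euclidean norm (the library norm on matrices is the sup norm). *)
Definition enorm (R : realType) n (x : 'rV[R]_n) : R :=
  Num.sqrt (\sum_(i < n) x 0 i ^+ 2).

Definition sphere (R : realType) n : set 'rV[R]_n := [set x | enorm x = 1].

(** Surface measure of the unit sphere of R^n, from Lebesgue measure in polar
    coordinates: the area of A is n times the volume of the cone
    {t a | a in A, 0 < t <= 1}.  It is a measure on R^n carried by the sphere. *)
Section surface_area.
Context {R : realType} (n : nat).

Definition punctured_ball : set 'rV[R]_n := [set x | 0 < enorm x <= 1].

Definition unit_dir (x : 'rV[R]_n) : 'rV[R]_n := (enorm x)^-1 *: x.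

Lemma measurable_enorm : measurable_fun setT (@enorm R n).
Proof.
apply: measurableT_comp.
  apply: open_continuous_measurable_fun; first exact: openT.
  by move=> x _; exact: sqrt_continuous.
apply: measurable_sum => i; apply: measurable_funX.
exact: (@measurable_coord_rV R n i).
Qed.

Lemma measurable_punctured_ball : measurable punctured_ball.
Proof.
rewrite (_ : punctured_ball = @enorm R n @^-1` `]0, 1]%classic); last first.
  by apply/seteqP; split => x; rewrite /punctured_ball/= in_itv.
by rewrite -[X in measurable X]setTI; exact: measurable_enorm.
Qed.

Let minv : measurable_fun setT (@GRing.inv R).
Proof.
rewrite -(setvU [set (0 : R)]); apply/measurable_funU => //.
  by apply: measurableC; exact: measurable_set1.
split; last exact: measurable_fun_set1.
apply: open_continuous_measurable_fun.
  by apply: closed_openC; exact: closed_eq.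
by move=> x; rewrite inE/= => /eqP x0; exact: inv_continuous.
Qed.

Lemma measurable_unit_dir : measurable_fun setT unit_dir.
Proof.
apply: measurable_fun_rV => i.
rewrite (_ : _ \o _ = fun x => (enorm x)^-1 * coord_rV i x); last first.
  by apply/funext => x /=; rewrite /coord_rV mxE.
apply: measurable_funM; last exact: measurable_coord_rV.
by apply: measurableT_comp; [exact: minv|exact: measurable_enorm].
Qed.

Definition surface_area (A : set 'rV[R]_n) : \bar R :=
  (n%:R%:E * lebesgue_rV n (unit_dir @^-1` A `&` punctured_ball))%E.

Let mD := measurable_punctured_ball.
Let mf := measurable_unit_dir.

Let surface_area0 : surface_area set0 = 0%E.
Proof. by rewrite /surface_area preimage_set0 set0I measure0 mule0. Qed.

Let surface_area_ge0 A : (0 <= surface_area A)%E.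
Proof. by rewrite /surface_area mule_ge0. Qed.

Let surface_area_sigma_additive : semi_sigma_additive surface_area.
Proof.
exact: (@measure_semi_sigma_additive _ _ _ (mscale n%:R%:nng
  (measure_function_pushforward__canonical__measure_function_Measure
    (mrestr (lebesgue_rV n) mD) mf))).
Qed.

HB.instance Definition _ := isMeasure.Build _ _ _ surface_area
  surface_area0 surface_area_ge0 surface_area_sigma_additive.

End surface_area.

Definition Gamma (R : realType) (s : R) : R :=
  \int[@lebesgue_measure R]_(t in `]0, +oo[) (t `^ (s - 1) * expR (- t)).

(** A formal expression [mu + i sigma] of R^d + iR is the pair [(mu, sigma)],
    and [mu + i 0] is identified with [mu].  The spaces R^(d+1) and R^d + iR are
    extended by a point at infinity, represented by [None]. *)
Section spherical_cauchy.
Context {R : realType} (d : nat).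

Definition half_plane : set ('rV[R]_d * R) := [set theta | 0 < theta.2].

Definition north : 'rV[R]_(d + 1) := delta_mx 0 (rshift d ord0).

Definition calP (z : option 'rV[R]_(d + 1)) : option ('rV[R]_d * R) :=
  match z with
  | None => Some (0, -1)
  | Some x =>
      if x == north then None
      else Some ((2 / enorm (x - north) ^+ 2) *: lsubmx x,
                 (1 - enorm x ^+ 2) / enorm (x - north) ^+ 2)
  end.

Definition calPinv (z : option ('rV[R]_d * R)) : option 'rV[R]_(d + 1) :=
  match z with
  | None => Some north
  | Some (mu, sigma) =>
      if (mu, sigma) == (0, -1) then None
      else Some ((2 / (enorm mu ^+ 2 + (1 + sigma) ^+ 2)) *:
                 row_mx mu (const_mx ((enorm mu ^+ 2 + sigma ^+ 2 - 1) / 2)))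
  end.

(** Density of C*_d(phi) with respect to surface area; meant for |phi| != 1. *)
Definition sphC_pdf (phi y : 'rV[R]_(d + 1)) : R :=
  Gamma (d.+1%:R / 2) / (2 * pi `^ (d.+1%:R / 2)) *
  (`|1 - enorm phi ^+ 2| / enorm (y - phi) ^+ 2) ^+ d.

(** Density of C_d(theta) with respect to Lebesgue measure; meant for
    theta.2 != 0. *)
Definition C_pdf (theta : 'rV[R]_d * R) (x : 'rV[R]_d) : R :=
  2 ^+ d.-1 * Gamma (d.+1%:R / 2) / pi `^ (d.+1%:R / 2) *
  (`|theta.2| / (theta.2 ^+ 2 + enorm (x - theta.1) ^+ 2)) ^+ d.

Definition sphC_law (phi : 'rV[R]_(d + 1)) (D : set 'rV[R]_(d + 1) -> \bar R) :=
  forall A, measurable A ->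
    D A = (\int[@surface_area R (d + 1)]_(y in A) (sphC_pdf phi y)%:E)%E.

Definition sphC_likelihood n (y : 'I_n -> 'rV[R]_(d + 1)) phi : R :=
  \prod_(j < n) sphC_pdf phi (y j).

Definition C_likelihood n (x : 'I_n -> 'rV[R]_d) theta : R :=
  \prod_(j < n) C_pdf theta (x j).

End spherical_cauchy.

Definition is_maximizer (R : realType) (T : Type) (D : set T) (L : T -> R)
    (t : T) :=
  D t /\ forall u, D u -> L u <= L t.

Definition sphC_mle (R : realType) d n (y : 'I_n -> 'rV[R]_(d + 1)) :=
  is_maximizer [set phi | enorm phi < 1] (sphC_likelihood y).

Definition C_mle (R : realType) d n (x : 'I_n -> 'rV[R]_d) :=
  is_maximizer (@half_plane R d) (C_likelihood x).

(** Mutual independence; the product rule for subfamilies is the case where some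
    of the events are [setT]. *)
Definition independent_RVs d d' (T : measurableType d) (T' : measurableType d')
    (R : realType) (P : probability T R) n (X : 'I_n -> {RV P >-> T'}) :=
  forall A : 'I_n -> set T', (forall j, measurable (A j)) ->
    P (\bigcap_j (X j @^-1` A j)) = (\prod_(j < n) P (X j @^-1` A j))%E.

(* Main.v *)
(** With M = |x|^2 + 1 and N = |mu|^2 + (1 + sigma)^2, the preimages y of x and
    phi of mu + i sigma under calP satisfy |y - phi|^2 = 4 (|x - mu|^2 + sigma^2) / (M N) and
    1 - |phi|^2 = 4 sigma / N.  Hence the two densities differ by a positive
    factor depending on the observation only, and the likelihoods are
    proportional along the bijection between the half-space and the ball.  The
    pole is null because it lies in a coordinate hyperplane, which contains the
    whole cone over it. *)
Require Import Defs.
From mathcomp Require Import all_boot all_order all_algebra.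
From mathcomp Require Import all_classical all_reals all_analysis.
From mathcomp Require Import ring.

Import Order.TTheory GRing.Theory Num.Theory.

Local Open Scope classical_set_scope.
Local Open Scope ring_scope.

(** * Squared Euclidean norms and rows split at the last coordinate *)

Section euclidean_norm.
Context {R : realType}.

Lemma enorm_ge0 n (x : 'rV[R]_n) : 0 <= enorm x.
Proof. exact: sqrtr_ge0. Qed.

Lemma sqr_enorm n (x : 'rV[R]_n) : enorm x ^+ 2 = \sum_(i < n) x 0 i ^+ 2.
Proof. by rewrite sqr_sqrtr // sumr_ge0 // => i _; exact: sqr_ge0. Qed.

Lemma enorm_eq0 n (x : 'rV[R]_n) : enorm x = 0 -> x = 0.
Proof.
move=> x0; have /eqP := sqr_enorm n x; rewrite x0 expr0n/= eq_sym => /eqP sx0.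
apply/rowP => i; rewrite mxE; apply/eqP; rewrite -sqrf_eq0; apply/eqP.
by apply: (psumr_eq0P _ sx0) => // j _; exact: sqr_ge0.
Qed.

Lemma enorm_lt1 n (x : 'rV[R]_n) : (enorm x < 1) = (enorm x ^+ 2 < 1).
Proof. by rewrite expr_lt1 // enorm_ge0. Qed.

Lemma sqr_enormZ n (a : R) (x : 'rV[R]_n) :
  enorm (a *: x) ^+ 2 = a ^+ 2 * enorm x ^+ 2.
Proof.
by rewrite !sqr_enorm mulr_sumr; apply: eq_bigr => i _; rewrite mxE exprMn.
Qed.

(** Keeping the inner product as an explicit sum gives [field] one atom common to all distances
    between multiples of the same two vectors. *)
Lemma sqr_enorm_lincomb n (a b : R) (x y : 'rV[R]_n) :
  enorm (a *: x - b *: y) ^+ 2 =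
  a ^+ 2 * enorm x ^+ 2 + b ^+ 2 * enorm y ^+ 2
  - 2 * a * b * \sum_(i < n) x 0 i * y 0 i.
Proof.
rewrite !sqr_enorm !mulr_sumr -big_split/= -sumrB.
by apply: eq_bigr => i _; rewrite !mxE; ring.
Qed.

Lemma sqr_enorm_row d (m : 'rV[R]_d) (t : R) :
  enorm (row_mx m (const_mx t : 'rV[R]_1)) ^+ 2 = enorm m ^+ 2 + t ^+ 2.
Proof.
rewrite !sqr_enorm big_split_ord/= big_ord1 row_mxEr mxE; congr (_ + _).
by apply: eq_bigr => i _; rewrite row_mxEl.
Qed.

Lemma row_mx_last d (y : 'rV[R]_(d + 1)) :
  y = row_mx (lsubmx y) (const_mx (y 0 (rshift d ord0)) : 'rV[R]_1).
Proof.
rewrite -{1}[y]hsubmxK; congr row_mx; apply/rowP => i.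
by rewrite !mxE ord1.
Qed.

Lemma row_mx_constB d (m x : 'rV[R]_d) (s t : R) :
  row_mx m (const_mx s : 'rV[R]_1) - row_mx x (const_mx t) =
  row_mx (m - x) (const_mx (s - t)).
Proof.
by rewrite opp_row_mx add_row_mx; congr row_mx; apply/rowP => i; rewrite !mxE.
Qed.

Lemma north_row d : @north R d = row_mx 0 (const_mx 1 : 'rV[R]_1).
Proof.
rewrite [LHS]row_mx_last; congr row_mx; last by rewrite mxE !eqxx.
apply/rowP => i; rewrite !mxE /= -val_eqE/= .
by rewrite addn0 (ltn_eqF (ltn_ord i)).
Qed.

End euclidean_norm.

(** * The bijection between half-space and ball, and the densities along it *)

Section stereographic.
Context {R : realType} {d : nat}.
Implicit Types (m x : 'rV[R]_d) (s t : R).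

(** The finite branch of [calPinv], freed of the [option]; [real_of] and [imag_of] below play the
    same role for [calP]. *)
Definition ball_of m s : 'rV[R]_(d + 1) :=
  (2 / (enorm m ^+ 2 + (1 + s) ^+ 2)) *:
    row_mx m (const_mx ((enorm m ^+ 2 + s ^+ 2 - 1) / 2)).

Definition real_of (y : 'rV[R]_(d + 1)) : 'rV[R]_d :=
  (2 / enorm (y - @north R d) ^+ 2) *: lsubmx y.

Definition imag_of (y : 'rV[R]_(d + 1)) : R :=
  (1 - enorm y ^+ 2) / enorm (y - @north R d) ^+ 2.

Lemma ball_of_row m s : ball_of m s =
  row_mx ((2 / (enorm m ^+ 2 + (1 + s) ^+ 2)) *: m)
   (const_mx ((enorm m ^+ 2 + s ^+ 2 - 1) / (enorm m ^+ 2 + (1 + s) ^+ 2))).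
Proof.
rewrite /ball_of scale_row_mx; congr row_mx; apply/rowP => i; rewrite !mxE.
by rewrite mulrACA mulrC -mulrA [2 ^-1 * _]mulrA mulVf ?mul1r // mulrC.
Qed.

Lemma calPinv_ball_of m s : 0 <= s -> calPinv (Some (m, s)) = Some (ball_of m s).
Proof.
move=> s0 /=; case: eqP => // -[_ s1].
by move: s0; rewrite s1 oppr_ge0 ler10.
Qed.

Lemma denom_gt0 m s : 0 <= s -> 0 < enorm m ^+ 2 + (1 + s) ^+ 2.
Proof.
by move=> s0; rewrite ltr_wpDl ?sqr_ge0 // exprn_gt0 // ltr_wpDr.
Qed.

Lemma one_sub_sqr_ball_of m s : 0 <= s ->
  1 - enorm (ball_of m s) ^+ 2 = 4 * s / (enorm m ^+ 2 + (1 + s) ^+ 2).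
Proof.
move=> /(denom_gt0 m)/gt_eqF/negbT.
rewrite ball_of_row sqr_enorm_row sqr_enormZ => N0; by field.
Qed.

(** As for an inversion, the squared distance is rescaled by a product of one factor per point. The
    case [t = 0] is that of an observation on the sphere. *)
Lemma sqr_dist_ball_of m s x t : 0 <= s -> 0 <= t ->
  enorm (ball_of x t - ball_of m s) ^+ 2 =
  4 * (enorm (x - m) ^+ 2 + (s - t) ^+ 2) /
  ((enorm x ^+ 2 + (1 + t) ^+ 2) * (enorm m ^+ 2 + (1 + s) ^+ 2)).
Proof.
move=> /(denom_gt0 m)/gt_eqF/negbT N0 /(denom_gt0 x)/gt_eqF/negbT M0.
(* Now both distances are linear combinations of [x] and [m] and expand by the same lemma. *)
have -> : x - m = 1 *: x - 1 *: m by rewrite !scale1r.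
rewrite !ball_of_row row_mx_constB.
rewrite sqr_enorm_row !sqr_enorm_lincomb; field.
by apply/andP.
Qed.

Lemma sqr_dist_north (y : 'rV[R]_(d + 1)) :
  enorm (y - @north R d) ^+ 2 =
  enorm y ^+ 2 + 1 - 2 * y 0 (rshift d ord0).
Proof.
rewrite north_row {1 2}[y]row_mx_last row_mx_constB.
by rewrite subr0 !sqr_enorm_row; ring.
Qed.

Lemma sqr_dist_north_gt0 (y : 'rV[R]_(d + 1)) :
  y != @north R d -> 0 < enorm (y - @north R d) ^+ 2.
Proof.
move=> yN; rewrite lt0r sqr_ge0 andbT sqrf_eq0; apply: contra yN => /eqP.
by move/enorm_eq0/eqP; rewrite subr_eq0.
Qed.

Lemma real_imag_ofK (y : 'rV[R]_(d + 1)) :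
  y != @north R d -> ball_of (real_of y) (imag_of y) = y.
Proof.
move=> /sqr_dist_north_gt0 E0; have E0' := lt0r_neq0 E0.
have EE := sqr_dist_north y.
have yE : enorm y ^+ 2 = enorm (lsubmx y) ^+ 2 + y 0 (rshift d ord0) ^+ 2.
  by rewrite {1}[y]row_mx_last sqr_enorm_row.
rewrite ball_of_row [RHS]row_mx_last /real_of /imag_of sqr_enormZ scalerA.
set E := enorm (y - _) ^+ 2 in E0 E0' EE *; set l := y 0 _ in EE yE *.
set L := enorm (lsubmx y) ^+ 2 in yE *; set q := enorm y ^+ 2 in EE yE *.
(* The denominator of [ball_of] at the image of [y] collapses to [4 / E], hence is nonzero, once [L]
   and [q] are expressed by [E] and the last coordinate [l]. *)
have NE : (2 / E) ^+ 2 * L + (1 + (1 - q) / E) ^+ 2 = 4 / E.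
  have -> : L = q - l ^+ 2 by rewrite yE addrK.
  have -> : q = E - 1 + 2 * l by rewrite EE; ring.
  by field.
rewrite NE; congr row_mx.
  by rewrite (_ : _ * _ = 1) ?scale1r //; field.
congr const_mx.
have -> : L = q - l ^+ 2 by rewrite yE addrK.
have -> : q = E - 1 + 2 * l by rewrite EE; ring.
by field.
Qed.

Lemma calP_sphere (y : 'rV[R]_(d + 1)) :
  sphere y -> y != @north R d -> calP (Some y) = Some (real_of y, 0).
Proof.
by move=> y1 /negPf yN; rewrite /= yN y1 expr1n subrr mul0r.
Qed.

Lemma sphere_ball_of (y : 'rV[R]_(d + 1)) :
  sphere y -> y != @north R d -> y = ball_of (real_of y) 0.
Proof.
move=> y1 yN; rewrite -{1}(real_imag_ofK y yN) /imag_of.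
by rewrite [enorm y]y1 expr1n subrr mul0r.
Qed.

Lemma ball_of_lt1 m s : 0 < s -> enorm (ball_of m s) < 1.
Proof.
move=> s0; rewrite enorm_lt1 -subr_gt0 one_sub_sqr_ball_of ?ltW //.
by rewrite divr_gt0 ?denom_gt0 ?ltW // mulr_gt0.
Qed.

(** The pole has norm at least 1, so [phi] differs from it, and [imag_of phi] has the sign of
    [1 - enorm phi ^+ 2]. *)
Lemma ball_of_onto (phi : 'rV[R]_(d + 1)) : enorm phi < 1 ->
  exists m s, 0 < s /\ phi = ball_of m s.
Proof.
move=> phi1; have phiN : phi != @north R d.
  apply/eqP => phiE; move: phi1; rewrite enorm_lt1 phiE north_row sqr_enorm_row.
  by rewrite expr1n gtrDr ltNge sqr_ge0.
exists (real_of phi), (imag_of phi); rewrite real_imag_ofK //; split => //.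
by rewrite divr_gt0 ?sqr_dist_north_gt0 // subr_gt0 -enorm_lt1.
Qed.

(** The quotient of the normalizing constants is [2 * 2 ^+ d.-1], which equals [2 ^+ d] only for
    positive [d]; the power of [enorm x ^+ 2 + 1] comes from the kernels. *)
Lemma C_pdf_ball_of m s x : 0 < s ->
  C_pdf (m, s) x = 2 * 2 ^+ d.-1 / (enorm x ^+ 2 + 1) ^+ d *
    sphC_pdf (ball_of m s) (ball_of x 0).
Proof.
move=> s0; have s0' := ltW s0; rewrite /C_pdf /sphC_pdf/=.
rewrite one_sub_sqr_ball_of // sqr_dist_ball_of // subr0 addr0 expr1n.
have N0 : 0 < enorm m ^+ 2 + (1 + s) ^+ 2 by rewrite denom_gt0 ?ltW.
have M0 : 0 < enorm x ^+ 2 + 1 by rewrite ltr_wpDl ?sqr_ge0.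
have D0 : 0 < enorm (x - m) ^+ 2 + s ^+ 2.
  by rewrite ltr_wpDl ?sqr_ge0 // exprn_gt0.
rewrite !gtr0_norm ?divr_gt0 ?mulr_gt0 // [s ^+ 2 + _]addrC.
set D := _ + s ^+ 2 in D0 *; set M := _ + 1 in M0 *; set N := _ + _ in N0 *.
(* The factor [N] of the parameter cancels; only [M], which depends on [x] alone, remains. *)
have -> : 4 * s / N / (4 * D / (M * N)) = M * (s / D).
  by field; rewrite !lt0r_neq0.
have p0 : (pi : R) `^ (d.+1%:R / 2) != 0.
  by rewrite lt0r_neq0 // powR_gt0 // pi_gt0.
have Md0 : M ^+ d != 0 by rewrite expf_neq0 // lt0r_neq0.
by rewrite [(M * _) ^+ d]exprMn; field; rewrite p0.
Qed.

End stereographic.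

(** * The pole has probability zero *)

Section negligible_north.
Context {R : realType}.

Lemma cons_rV0 n (a : R) (v : 'rV[R]_n) : cons_rV (a, v) 0 ord0 = a.
Proof.
have -> : ord0 = lshift n ord0 :> 'I_(1 + n) by exact: val_inj.
by rewrite /cons_rV [LHS](@row_mxEl _ 1 1 n) mxE.
Qed.

(** Coordinate 0 is the outermost factor of the iterated product, so the hyperplane is a null
    singleton times the whole space. *)
Lemma lebesgue_rV_hyperplane n :
  lebesgue_rV n.+1 [set x : 'rV[R]_n.+1 | x 0 ord0 = 0] = 0%E.
Proof.
rewrite /= /lebesgue_rVS /pushforward.
have -> : (@cons_rV R n @^-1` [set x : 'rV[R]_n.+1 | x 0 ord0 = 0]) =
    [set 0] `*` setT.
  by apply/seteqP; split => -[a v] /=; rewrite cons_rV0 => // -[].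
by rewrite product_measure1E // [X in (X * _)%E]lebesgue_measure_set1 mul0e.
Qed.

Lemma measurable_rV_set1 n (a : 'rV[R]_n) : measurable [set a].
Proof.
have -> : [set a] = \big[setI/setT]_(i < n) (coord_rV i @^-1` [set a 0 i]).
  rewrite -bigcap_seq; apply/seteqP; split => [_ -> i //|x xa].
  by apply/rowP => i; apply: xa => /=; rewrite mem_index_enum.
apply: bigsetI_measurable => i _.
by rewrite -[X in measurable X]setTI; apply: measurable_coord_rV.
Qed.

Lemma surface_area_hyperplane n (A : set 'rV[R]_n.+1) : measurable A ->
  A `<=` [set x | x 0 ord0 = 0] -> surface_area A = 0%E.
Proof.
move=> mA Ah; rewrite /surface_area; apply/eqP; rewrite mule_eq0; apply/orP; right.
apply/eqP; apply: subset_measure0 (lebesgue_rV_hyperplane n).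
- apply: measurableI; last exact: measurable_punctured_ball.
  by rewrite -[X in measurable X]setTI; apply: measurable_unit_dir.
- have -> : [set x : 'rV[R]_n.+1 | x 0 ord0 = 0] = coord_rV ord0 @^-1` [set 0] by [].
  by rewrite -[X in measurable X]setTI; apply: measurable_coord_rV.
(* On the punctured ball the norm is positive, so rescaling to the unit direction does not affect
   whether coordinate 0 vanishes. *)
- move=> x [/Ah /= xA /andP[x0 _]]; move: xA; rewrite mxE => /eqP.
  by rewrite mulf_eq0 invr_eq0 (gt_eqF x0) => /eqP.
Qed.

(** A law with a density charges no set of zero surface area. For [0 < d] the first and last
    coordinates differ, so coordinate 0 of the pole is 0; for [d = 0] the pole would be an atom. *)
Lemma sphC_law_north d (phi : 'rV[R]_(d + 1)) D :
  (0 < d)%N -> sphC_law phi D -> D [set @north R d] = 0%E.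
Proof.
case: d phi D => // d phi D _ ->; last exact: measurable_rV_set1.
apply: null_set_integral; [exact: measurable_rV_set1|exact: measurable_fun_set1|].
apply: (@surface_area_hyperplane (d + 1)); first exact: measurable_rV_set1.
by move=> _ ->; rewrite /north /= mxE.
Qed.

End negligible_north.

(** * Almost sure avoidance of the pole and transfer of maximizers *)

Theorem theorem9 (R : realType) (d n : nat) (phi : 'rV[R]_(d + 1))
    (disp : measure_display) (Omega : measurableType disp)
    (P : probability Omega R) (Y : 'I_n -> {RV P >-> 'rV[R]_(d + 1)}) :
  (1 <= d)%N -> enorm phi < 1 ->
  (forall j w, sphere (Y j w)) ->
  (forall j, sphC_law phi (distribution P (Y j))) ->
  independent_RVs Y ->
  {ae P, forall w, forall j, Y j w != north d} /\
  forall w, (forall j, Y j w != north d) ->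
    exists x : 'I_n -> 'rV[R]_d,
      (forall j, calP (Some (Y j w)) = Some (x j, 0)) /\
      forall phihat : 'rV[R]_(d + 1),
        sphC_mle (fun j => Y j w) phihat <->
        exists2 thetahat, C_mle x thetahat & Some phihat = calPinv (Some thetahat).
Proof.
move=> d0 _ Ysph Ylaw _; split.
  apply: filter_forall => j; exists (Y j @^-1` [set north d]); split.
  - by rewrite -[X in measurable X]setTI; apply: measurable_funPT => //;
      exact: measurable_rV_set1.
  - exact: sphC_law_north d phi _ d0 (Ylaw j).
  - by move=> w /= /negP; rewrite negbK => /eqP.
move=> w YN; pose x j := real_of (Y j w); exists x; split => [j|phihat].
  exact: calP_sphere.
(* The product of the observation factors does not involve the parameter, so it cancels from every
   comparison of likelihoods. *)
pose k : R := \prod_(j < n) (2 * 2 ^+ d.-1 / (enorm (x j) ^+ 2 + 1) ^+ d).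
have k0 : 0 < k.
  apply: prodr_gt0 => j _; rewrite divr_gt0 ?mulr_gt0 ?exprn_gt0 //.
  by rewrite ltr_wpDl ?sqr_ge0.
have likE m s : 0 < s ->
    C_likelihood x (m, s) = k * sphC_likelihood (fun j => Y j w) (ball_of m s).
  move=> s0; rewrite /C_likelihood /sphC_likelihood -big_split/=.
  apply: eq_bigr => j _; rewrite C_pdf_ball_of //; congr (_ * sphC_pdf _ _).
  by rewrite -sphere_ball_of.
split.
  move=> [phi1 phimax]; have [m [s [s0 phiE]]] := ball_of_onto phihat phi1.
  exists (m, s); last by rewrite calPinv_ball_of ?ltW // phiE.
  split => // -[m' s'] /= s0'; rewrite !likE // ler_pM2l // -phiE.
  by apply: phimax; exact: ball_of_lt1.
move=> [[m s] [s0 thetamax]]; rewrite calPinv_ball_of ?ltW // => -[->].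
(* Surjectivity onto the ball turns each competitor [phi'] into a competitor in the half-space. *)
split => /= [|phi' /ball_of_onto[m' [s' [s0' ->]]]]; first exact: ball_of_lt1.
by rewrite -(ler_pM2l k0) -!likE //; exact: thetamax.
Qed.
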